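(* The chromatic symmetric function $X_{P_{n,\ell}}$ of the path $P_n$ twinned at the interior vertex $\ell$ satisfies, for $\ell\ge 2$, $n\ge\ell+1$ and $n\ge 4$, the $e$-positive recurrence $$X_{P_{n,\ell}}=\sum_{j=2}^{n-\ell-1}(j-1)e_jX_{P_{n-j,\ell}}+4(n+1)e_{n+1}+2n\,e_1e_n+2e_1\sum_{j=n-\ell+2}^{n-1}(j-1)e_jX_{P_{n-j}}$$ $$\qquad+4\sum_{j=n-\ell+3}^{n}(j-1)e_jX_{P_{n+1-j}}+2\sum_{j=n-\ell+1}^{n-\ell+2}(j-2)e_jX_{P_{n+1-j}}+(n-\ell-2)e_{n-\ell}X_{P_{\ell,\ell}}.$$ Thus, for $n\ge 3$ and $2\le\ell\le n-1$, $X_{P_{n,\ell}}$ is $e$-positive.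
   Context: The chromatic symmetric function of a finite simple graph $H=(V,E)$ is $X_H=\sum_\kappa\prod_{u\in V}x_{\kappa(u)}$, the sum over all proper colorings $\kappa:V\to\mathbb{Z}_{>0}$. $P_n$ is the path with vertices $1,2,\dots,n$ in order. The twin of a graph at a vertex $v$ is obtained by adding a new vertex $v'$ joined to $v$ and to all neighbors of $v$. $P_{n,\ell}$ denotes $P_n$ twinned at the vertex $\ell$; in particular $P_{\ell,\ell}$ is the path $P_\ell$ twinned at its leaf $\ell$. $e_i$ is the $i$-th elementary symmetric function; a symmetric function is $e$-positive if its expansion in the basis of elementary symmetric functions has nonnegative coefficients. Empty sums are zero. *)

(* Defs.v *)
From HB Require Import structures.
From mathcomp Require Import all_boot all_order all_algebra.
From mathcomp Require Import finmap multiset.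
From mathcomp Require Import boolp classical_sets functions cardinality fsbigop.

Set Implicit Arguments.
Unset Strict Implicit.
Unset Printing Implicit Defensive.

Import GRing.Theory.

Local Open Scope ring_scope.
Local Open Scope mset_scope.

(** * Formal power series over the integers in countably many variables *)

(* The monomial x_0^(m 0) x_1^(m 1) ... is the finite multiset [m].  The
   variables are indexed by [nat] instead of the positive integers. *)
Record mser := MSer { mcoef : {mset nat} -> int }.

Local Notation "f @_ m" := (mcoef f m%mset)
  (at level 3, m at level 2, format "f @_ m") : ring_scope.

HB.instance Definition _ := gen_eqMixin mser.
HB.instance Definition _ := gen_choiceMixin mser.

Lemma mserP (f g : mser) : (forall m, f@_m = g@_m) -> f = g.
Proof. by case: f => f; case: g => g fg; congr MSer; apply/funext. Qed.

(* All sub-multisets of [m], i.e. all monomial divisors, without repetition. *)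
Definition msubs (m : {mset nat}) : seq {mset nat} :=
  undup [seq seq_mset (mask t m) | t : (size m).-tuple bool].

Lemma msubs_uniq m : uniq (msubs m).
Proof. exact: undup_uniq. Qed.

Lemma mem_msubs (m a : {mset nat}) : (a \in msubs m) = (a `<=` m).
Proof.
rewrite mem_undup; apply/mapP/idP => [[t _ ->]|/msubsetP am].
  apply/msubsetP => x; rewrite mset_seqE -[m x]count_mem_mset.
  by rewrite leq_count_subseq // mask_subseq.
have /count_subseqP[s /subseqP[t szt ->] pt] :
    forall x, (count_mem x a <= count_mem x m)%N.
  by move=> x; rewrite !count_mem_mset.
move/eqP: szt => szt; exists (Tuple szt); first by rewrite mem_enum.
by rewrite -[LHS]seq_mset_id; apply/eq_seq_msetP.
Qed.

Definition mser0 : mser := MSer (fun=> 0).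
Definition mser1 : mser := MSer (fun m => (m == mset0)%:R).
Definition mser_opp (f : mser) : mser := MSer (fun m => - f@_m).
Definition mser_add (f g : mser) : mser := MSer (fun m => f@_m + g@_m).
Definition mser_mul (f g : mser) : mser :=
  MSer (fun m => \sum_(a <- msubs m) f@_a * g@_(m `\` a)).

Fact mser_addA : associative mser_add.
Proof. by move=> f g h; apply: mserP => m; rewrite /= addrA. Qed.
Fact mser_addC : commutative mser_add.
Proof. by move=> f g; apply: mserP => m; rewrite /= addrC. Qed.
Fact mser_add0 : left_id mser0 mser_add.
Proof. by move=> f; apply: mserP => m; rewrite /= add0r. Qed.
Fact mser_addN : left_inverse mser0 mser_opp mser_add.
Proof. by move=> f; apply: mserP => m; rewrite /= addNr. Qed.

HB.instance Definition _ :=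
  GRing.isZmodule.Build mser mser_addA mser_addC mser_add0 mser_addN.

Lemma msubs_rev m (F : {mset nat} -> {mset nat} -> int) :
  \sum_(a <- msubs m) F a (m `\` a) = \sum_(a <- msubs m) F (m `\` a) a.
Proof.
have pm : perm_eq (msubs m) [seq m `\` a | a <- msubs m].
  apply: uniq_perm; rewrite ?msubs_uniq //.
    rewrite map_inj_in_uniq ?msubs_uniq // => a b.
    by rewrite !mem_msubs => am bm eab; rewrite -(msetBBK am) eab msetBBK.
  move=> a; rewrite mem_msubs; apply/idP/mapP => [am|[b _ ->]].
    exists (m `\` a); rewrite ?msetBBK // mem_msubs.
    by apply/msubsetP => x; rewrite msetE2 leq_subr.
  by apply/msubsetP => x; rewrite msetE2 leq_subr.
rewrite (perm_big _ pm) big_map big_seq [RHS]big_seq /=.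
by apply: eq_bigr => a; rewrite mem_msubs => am; rewrite msetBBK.
Qed.

Lemma msubs_exchange m (F : {mset nat} -> {mset nat} -> int) :
  \sum_(b <- msubs m) \sum_(a <- msubs b) F a b =
  \sum_(a <- msubs m) \sum_(c <- msubs (m `\` a)) F a (a `+` c).
Proof.
transitivity (\sum_(b <- msubs m) \sum_(a <- msubs m | a `<=` b) F a b).
  rewrite big_seq [RHS]big_seq; apply: eq_bigr => b; rewrite mem_msubs => bm.
  rewrite -[RHS]big_filter; apply: perm_big; apply: uniq_perm.
  - exact: msubs_uniq.
  - exact/filter_uniq/msubs_uniq.
  move=> a; rewrite mem_filter !mem_msubs andb_idr // => ab.
  exact: msubset_trans bm.
rewrite (exchange_big_dep xpredT) //= big_seq [RHS]big_seq.
apply: eq_bigr => a; rewrite mem_msubs => am.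
rewrite -big_filter -(big_map (fun c => a `+` c) xpredT (F a)).
apply: perm_big; apply: uniq_perm.
- exact/filter_uniq/msubs_uniq.
- by rewrite (map_inj_uniq (can_inj (@msetDKB _ a))) msubs_uniq.
move=> b; rewrite mem_filter mem_msubs; apply/andP/mapP => [[ab bm]|[c]].
  by exists (b `\` a); rewrite ?msetBDKC // mem_msubs msetSB.
rewrite mem_msubs => cm ->; split.
  by apply/msubsetP => x; rewrite msetE2 leq_addr.
by rewrite -(msetBDKC am) msetDS.
Qed.

Fact mser_mulC : commutative mser_mul.
Proof.
move=> f g; apply: mserP => m /=; rewrite (msubs_rev m (fun a b => f@_a * g@_b)).
by apply: eq_bigr => a _; rewrite mulrC.
Qed.

Fact mser_mulA : associative mser_mul.
Proof.
move=> f g h; apply: mserP => m /=; symmetry.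
under eq_bigr do rewrite mulr_suml.
rewrite (msubs_exchange m (fun a b => f@_a * g@_(b `\` a) * h@_(m `\` b))).
apply: eq_bigr => a _; rewrite mulr_sumr; apply: eq_bigr => c _.
by rewrite msetDKB msetBDA mulrA.
Qed.

Fact mser_mul1 : left_id mser1 mser_mul.
Proof.
move=> f; apply: mserP => m /=.
rewrite (bigD1_seq mset0) ?msubs_uniq ?mem_msubs ?msub0set //= eqxx mul1r msetB0.
by rewrite big1 ?addr0 // => a /negPf ->; rewrite mul0r.
Qed.

Fact mser_mulDl : left_distributive mser_mul mser_add.
Proof.
move=> f g h; apply: mserP => m /=; rewrite -big_split.
by apply: eq_bigr => a _; rewrite mulrDl.
Qed.

Fact mser1_neq0 : mser1 != mser0.
Proof. by apply/eqP => /(congr1 (fun f => f@_mset0)) /=; rewrite eqxx. Qed.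

HB.instance Definition _ := GRing.Zmodule_isComNzRing.Build mser
  mser_mulA mser_mulC mser_mul1 mser_mulDl mser1_neq0.

Definition mvar (i : nat) : mser := MSer (fun m => (m == [mset i])%:R).

(* The possibly infinite sum of a family of series, coefficient by
   coefficient; it is meaningful when every monomial occurs in only finitely
   many members of the family (see [summable]). *)
Definition msum (I : choiceType) (A : set I) (F : I -> mser) : mser :=
  MSer (fun m => \sum_(i \in A) (F i)@_m).

Definition summable (I : choiceType) (A : set I) (F : I -> mser) : Prop :=
  forall m, finite_set [set i | A i /\ (F i)@_m <> 0].

(** * Elementary symmetric functions and e-positivity *)

Definition elemsym (k : nat) : mser :=
  msum [set S : {fset nat} | #|` S| = k] (fun S => \prod_(i <- S) mvar i).

Definition elemsym_part (la : seq nat) : mser := \prod_(i <- la) elemsym i.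

Definition is_part (la : seq nat) : bool := sorted geq la && (0%N \notin la).

Definition e_expansion (f : mser) (c : {fsfun seq nat -> int with 0}) : Prop :=
  {in finsupp c, forall la, is_part la} /\
  f = \sum_(la <- finsupp c) (c la)%:~R * elemsym_part la.

(* As the e_la form a basis of the symmetric functions, [c] is unique. *)
Definition e_positive (f : mser) : Prop :=
  exists2 c, e_expansion f c & forall la, 0 <= c la.

(** * Graphs and the chromatic symmetric function *)

Record sgraph := SGraph {
  vertex : finType;
  edge : rel vertex;
  edge_sym : symmetric edge;
  edge_irrefl : irreflexive edge }.

Definition proper_coloring (H : sgraph) (k : {ffun vertex H -> nat}) : Prop :=
  forall u v, edge u v -> k u <> k v.

Definition chromsym (H : sgraph) : mser :=
  msum [set k | proper_coloring k] (fun k => \prod_(u : vertex H) mvar (k u)).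

(* Vertex number i of the path (1 <= i <= n) is the ordinal i - 1. *)
Definition path_edge (n : nat) : rel 'I_n :=
  [rel i j : 'I_n | (i.+1 == j) || (j.+1 == i)].

Fact path_edge_sym n : symmetric (@path_edge n).
Proof. by move=> i j; rewrite /path_edge /= orbC. Qed.

Fact path_edge_irrefl n : irreflexive (@path_edge n).
Proof. by move=> i; rewrite /path_edge /= orbb gtn_eqF. Qed.

Definition path_graph (n : nat) : sgraph :=
  SGraph (@path_edge_sym n) (@path_edge_irrefl n).

(* [None] is the new vertex. *)
Definition twin_edge (H : sgraph) (v : vertex H) : rel (option (vertex H)) :=
  fun x y => match x, y with
  | Some a, Some b => edge a b
  | Some a, None | None, Some a => (a == v) || edge v a
  | None, None => false
  end.

Fact twin_edge_sym H v : symmetric (@twin_edge H v).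
Proof. by case=> [a|] [b|] //=; rewrite edge_sym. Qed.

Fact twin_edge_irrefl H v : irreflexive (@twin_edge H v).
Proof. by case=> [a|] //=; rewrite edge_irrefl. Qed.

Definition twin (H : sgraph) (v : vertex H) : sgraph :=
  SGraph (@twin_edge_sym H v) (@twin_edge_irrefl H v).

(* The path with n vertices twinned at its vertex number l, 1 <= l <= n (and
   the bare path for any other l). *)
Definition twinned_path (n l : nat) : sgraph :=
  if [pick v : 'I_n | v.+1 == l] is Some v then @twin (path_graph n) v
  else path_graph n.

(** * The infinite sums above are well defined *)

Lemma coef_prod_mvar (s : seq nat) m :
  (\prod_(i <- s) mvar i)@_m = (m == seq_mset s)%:R.
Proof.
elim: s m => [|i s IHs] m.
  rewrite big_nil /=; congr (nat_of_bool (m == _))%:R.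
  by apply/msetP => x; rewrite mset0E mset_seqE.
rewrite big_cons mset_cons /=; under eq_bigr do rewrite IHs.
have [im|nim] := boolP ([mset i] `<=` m).
  rewrite (bigD1_seq [mset i]) ?msubs_uniq ?mem_msubs //= eqxx mul1r.
  rewrite big1 ?addr0 => [|a /negPf ->]; last by rewrite mul0r.
  congr (nat_of_bool _)%:R; apply/eqP/eqP => [<-|->]; first by rewrite msetBDKC.
  by rewrite msetDKB.
rewrite big_seq big1 => [|a]; last first.
  rewrite mem_msubs => am; case: eqP => [ea|_]; last by rewrite mul0r.
  by rewrite -ea am in nim.
case: eqP => // em; case/negP: nim; rewrite em.
by apply/msubsetP => x; rewrite msetE2 leq_addr.
Qed.

Lemma summable_elemsym (k : nat) :
  summable [set S : {fset nat} | #|` S| = k] (fun S => \prod_(i <- S) mvar i).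
Proof.
move=> m; apply: (sub_finite_set _ (finite_fset (fpowerset (finsupp m)))).
move=> S /= [_]; rewrite coef_prod_mvar; case: eqP => // -> _.
rewrite fpowersetE; apply/fsubsetP => x xS.
by rewrite msuppE in_mset mset_seqE -has_count has_pred1.
Qed.

Lemma summable_chromsym (H : sgraph) :
  summable [set k : {ffun vertex H -> nat} | proper_coloring k]
    (fun k => \prod_(u : vertex H) mvar (k u)).
Proof.
move=> m.
pose ext (g : {ffun vertex H -> finsupp m}) : {ffun vertex H -> nat} :=
  [ffun u => val (g u)].
apply: (sub_finite_set _ (finite_image ext (@finite_finset _ setT))) => k /= [_].
rewrite -(big_map (fun u => k u) xpredT mvar) coef_prod_mvar.
case: eqP => // em _.
have km u : k u \in finsupp m.
  by rewrite msuppE in_mset em mset_seqE -has_count has_pred1 map_f ?mem_index_enum.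
exists [ffun u => [` km u]%fset] => //.
by apply/ffunP => u; rewrite !ffunE.
Qed.

(* Main.v *)
From HB Require Import structures.
Require Import Defs.
From mathcomp Require Import boolp classical_sets functions fsbigop.
From mathcomp Require Import all_boot all_order all_algebra.
From mathcomp Require Import finmap multiset ring zify.

Set Implicit Arguments.
Unset Strict Implicit.
Unset Printing Implicit Defensive.

Import GRing.Theory.

Local Open Scope ring_scope.

(** Restrict to finitely many colours and write P_n for the chromatic symmetric
    function of the path on n vertices, f_n(c) for its part in which the first
    vertex has colour c, and D_j(c) for the part of e_j whose monomials contain
    x_c.  Both families obey the same recursion,
      f_(n+1)(c) = x_c (P_n - f_n(c)),   D_(j+1)(c) = x_c (e_j - D_j(c)),
    with sum_c f_n(c) = P_n for n > 0 and sum_c D_j(c) = j e_j.  Playing the two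
    recursions against each other in sum_c f_n(c) D_j(c) telescopes to
      P_n = e_n + sum_(j = 2..n) (j - 1) e_j P_(n-j),
    and in sum_c f_a(c) f_b(c) gives P_a P_b - P_(a+b).  A colouring of the path
    twinned at l consists of distinct colours c, d for the twins and of two
    shorter paths whose end colours avoid c and d, so with a = l - 1, b = n - l
    its generating function is
      sum_(c <> d) x_c x_d (P_a - f_a(c) - f_a(d)) (P_b - f_b(c) - f_b(d)),
    which the previous identities evaluate to
      4 P_(n+1) + 2 e_1 P_n - 2 P_l P_(n-l+1) - 2 P_(l-1) P_(n-l+2)
        - 2 P_(l+1) P_(n-l) + 2 e_2 P_(l-1) P_(n-l).
    Applying the path recursion to this closed form yields the recurrence.  Its
    last coefficient n - l - 2 is negative only for l = n - 1; there positivity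
    comes from the symmetry l <-> n + 1 - l of the closed form, which reduces to
    l = 2, and from the value 16 e_4 + 2 e_3 e_1 for n = 3. *)

(** * Consequences of the two transfer recursions *)

Section TransferRecursion.
Variables (R : comNzRingType) (C : finType) (x : C -> R).
Variables (P E : nat -> R) (f D : nat -> C -> R).
Hypotheses (P0 : P 0 = 1) (E0 : E 0 = 1).
Hypotheses (f0 : forall c, f 0 c = 0) (D0 : forall c, D 0 c = 0).
Hypothesis fS : forall n c, f n.+1 c = x c * (P n - f n c).
Hypothesis DS : forall n c, D n.+1 c = x c * (E n - D n c).
Hypothesis sum_fS : forall n, \sum_c f n.+1 c = P n.+1.
Hypothesis sum_D : forall n, \sum_c D n c = n%:R * E n.

Let sum_x : \sum_c x c = E 1.
Proof.
rewrite -[E 1]mul1r -(sum_D 1); apply: eq_bigr => c _.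
by rewrite DS E0 D0 subr0 mulr1.
Qed.

Let P1 : P 1 = E 1.
Proof.
by rewrite -sum_fS -sum_x; apply: eq_bigr => c _; rewrite fS P0 f0 subr0 mulr1.
Qed.

Let sum_xf n : \sum_c x c * f n c = E 1 * P n - P n.+1.
Proof.
rewrite -sum_fS -sum_x mulr_suml -sumrB.
by apply: eq_bigr => c _; rewrite fS; ring.
Qed.

Let sum_xD n : \sum_c x c * D n c = E 1 * E n - n.+1%:R * E n.+1.
Proof.
rewrite -sum_D -sum_x mulr_suml -sumrB.
by apply: eq_bigr => c _; rewrite DS; ring.
Qed.

(** The products $f_{a+1}f_b$ and $f_af_{b+1}$ contain the same term $-x_cf_af_b$. Their difference
    is thus linear in [f] and evaluated by [sum_xf], so the induction moves one vertex at a time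
    from the first path to the second. *)
Let sum_ff a b : \sum_c f a c * f b c = P a * P b - P (a + b)%N.
Proof.
elim: a b => [|a IHa] b.
  by rewrite big1 => [|c _]; rewrite ?f0 ?mul0r // P0 mul1r subrr.
rewrite (_ : \sum_c _ = \sum_c f a c * f b.+1 c + P a * (\sum_c x c * f b c)
    - P b * (\sum_c x c * f a c)).
  by rewrite IHa !sum_xf addSnnS; ring.
rewrite !mulr_sumr -big_split -sumrB; apply: eq_bigr => c _ /=.
by rewrite !fS; ring.
Qed.

Lemma path_recursion n :
  P n = E n + \sum_(2 <= j < n.+1) (j%:R - 1) * E j * P (n - j)%N.
Proof.
pose B j m := \sum_c f m c * D j c.
have B_step j m : B j m.+1 - B j.+1 m = E j * P m.+1 - j.+1%:R * E j.+1 * P m.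
  transitivity (P m * (\sum_c x c * D j c) - E j * (\sum_c x c * f m c)).
    rewrite !mulr_sumr -!sumrB; apply: eq_bigr => c _; rewrite fS DS; ring.
  rewrite sum_xf sum_xD; ring.
(* [B_step] is summed along $j+m=n-1$. The two boundary terms [B 0 n] and [B n 0] vanish because
   $D_0=f_0=0$. *)
have tele : \sum_(0 <= j < n) (E j * P (n - j)%N
    - j.+1%:R * E j.+1 * P (n - j.+1)%N) = 0.
  rewrite (@telescope_sumr_eq _ _ _ (fun j => - B j (n - j)%N)) // => [|j /andP[_ jn]].
    rewrite subnn subn0 /B !big1 ?subrr // => c _; first by rewrite D0 mulr0.
    by rewrite f0 mul0r.
  by rewrite -(subnSK jn) -B_step opprK addrC.
move/eqP: tele; rewrite sumrB subr_eq0 => /eqP tele.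
have : \sum_(0 <= j < n.+1) E j * P (n - j)%N
     = E n + \sum_(0 <= j < n.+1) j%:R * E j * P (n - j)%N.
  rewrite big_nat_recr //= subnn P0 mulr1 addrC tele.
  by rewrite [in RHS]big_nat_recl // mul0r mul0r add0r.
case: n {tele} => [|n] H; first by rewrite big_geq // E0 P0 addr0.
(* The term $j=0$ is $P_{n+1}$ on the left and zero on the right. The terms at $j=1$ agree and
   cancel, so the remaining sum starts at 2. *)
rewrite ![\sum_(0 <= j < n.+2) _]big_nat_recl // in H.
rewrite ![\sum_(0 <= j < n.+1) _]big_nat_recl //= E0 !subn0 in H.
have -> : \sum_(2 <= j < n.+2) (j%:R - 1) * E j * P (n.+1 - j)%N =
  \sum_(0 <= i < n) i.+2%:R * E i.+2 * P (n.+1 - i.+2)%N -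
  \sum_(0 <= i < n) E i.+2 * P (n.+1 - i.+2)%N.
  rewrite -sumrB big_add1 big_add1 /=; apply: eq_bigr => i _; ring.
move: H; rewrite !mul1r !mul0r add0r addrCA [RHS]addrCA => /addrI H.
by rewrite addrA -H addrK.
Qed.

Lemma twin_sum a b :
  \sum_c \sum_(d | c != d) x c * x d * ((P a - f a c - f a d) * (P b - f b c - f b d))
  = 4 * P (a + b).+2 + 2 * E 1 * P (a + b).+1 - 2 * P a.+1 * P b.+1
    - 2 * P a * P b.+2 - 2 * P a.+2 * P b + 2 * E 2 * P a * P b.
Proof.
pose F c d := x c * x d * ((P a - f a c - f a d) * (P b - f b c - f b d)).
have offdiag c : \sum_(d | c != d) F c d = \sum_d F c d - F c c.
  rewrite [in RHS](bigD1 c) //= addrAC subrr add0r.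
  by apply: eq_bigl => d; rewrite eq_sym.
rewrite (eq_bigr _ (fun c _ => offdiag c)) sumrB.
have xff : \sum_c x c * f a c * f b c
    = P a * (\sum_c x c * f b c) - \sum_c f a.+1 c * f b c.
  by rewrite mulr_sumr -sumrB; apply: eq_bigr => c _; rewrite fS; ring.
have p2 : \sum_c x c * x c = E 1 * E 1 - P 2.
  rewrite -{2}P1 -sum_xf; apply: eq_bigr => c _.
  by rewrite fS P0 f0 subr0 mulr1.
have P2 : P 2 = 2 * E 2.
  by rewrite path_recursion big_nat1 subnn P0; ring.
(* On the diagonal, $x_c(P_a-2f_a(c))=2f_{a+1}(c)-x_cP_a$, and likewise for $b$; the right side is
   the expanded product. *)
have diag : \sum_c F c c = 4 * (\sum_c f a.+1 c * f b.+1 c)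
    - 2 * P a * (\sum_c x c * f b.+1 c) - 2 * P b * (\sum_c x c * f a.+1 c)
    + P a * P b * (\sum_c x c * x c).
  rewrite !mulr_sumr -!sumrB -big_split; apply: eq_bigr => c _ /=.
  by rewrite !fS /F; ring.
(* Every monomial of [F c d] is a function of $c$ times a function of $d$, so the full double sum
   splits into products of single sums. *)
have row c : \sum_d F c d = x c * (P a * P b * E 1
      - P a * (\sum_d x d * f b d) - P b * (\sum_d x d * f a d)
      + \sum_d x d * f a d * f b d)
    - E 1 * P a * (x c * f b c) - E 1 * P b * (x c * f a c)
    + E 1 * (x c * f a c * f b c) + (\sum_d x d * f b d) * (x c * f a c)
    + (\sum_d x d * f a d) * (x c * f b c).
  rewrite -sum_x mulrDr !mulrBr !mulr_sumr !mulr_suml -?sumrB.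
  rewrite -!(big_split, sumrB) /=.
  by apply: eq_bigr => d _; rewrite /F; ring.
rewrite (eq_bigr _ (fun c _ => row c)) !(big_split, sumrN) /=.
rewrite -!mulr_suml -!mulr_sumr diag xff p2 !sum_xf sum_x !sum_ff P2 addnS !addSn.
ring.
Qed.
End TransferRecursion.

(** * Colourings with finitely many colours *)

Section FiniteColours.
Variables (R : comNzRingType) (C : finType) (x : C -> R).

Definition fin_elemsym (k : nat) : R :=
  \sum_(S : {set C} | #|S| == k) \prod_(c in S) x c.

Definition fin_elemsym_at (k : nat) (c : C) : R :=
  \sum_(S : {set C} | (#|S| == k) && (c \in S)) \prod_(d in S) x d.

Lemma fin_elemsym0 : fin_elemsym 0 = 1.
Proof.
rewrite /fin_elemsym (big_pred1 set0) ?big_set0 // => S.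
by rewrite cards_eq0.
Qed.

Lemma fin_elemsym_at0 c : fin_elemsym_at 0 c = 0.
Proof.
rewrite /fin_elemsym_at big_pred0 // => S; rewrite cards_eq0.
by apply/negP => /andP[/eqP ->]; rewrite inE.
Qed.

(** Removing $c$ is a bijection from the $(k+1)$-sets containing $c$ to the $k$-sets avoiding it. *)
Lemma fin_elemsym_atS k c :
  fin_elemsym_at k.+1 c = x c * (fin_elemsym k - fin_elemsym_at k c).
Proof.
rewrite /fin_elemsym (bigID (fun S : {set C} => c \in S)) /= addrC addrK mulr_sumr.
rewrite /fin_elemsym_at (reindex_onto (fun S => c |: S) (fun S => S :\ c)) /=.
  apply: eq_big => [S|S /andP[_ cS]].
    rewrite setU11 andbT; have [cS|cS] := boolP (c \in S).
      rewrite andbF; apply/negP => /andP[_ /eqP eS].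
      by move: cS; rewrite -eS !inE eqxx.
    by rewrite setU1K // eqxx cardsU1 cS add1n eqSS !andbT.
  rewrite big_setU1 //; apply/negP => cS'.
  by move: cS => /eqP eS; move: cS'; rewrite -eS !inE eqxx.
by move=> S /andP[_ cS]; rewrite setD1K.
Qed.

(** Double counting: a $k$-set occurs once for each of its elements. *)
Lemma sum_fin_elemsym_at k : \sum_c fin_elemsym_at k c = k%:R * fin_elemsym k.
Proof.
rewrite /fin_elemsym_at (exchange_big_dep (fun S : {set C} => #|S| == k)) /=.
  rewrite mulr_sumr; apply: eq_bigr => S /eqP <-.
  rewrite (eq_bigl (fun c => c \in S)) => [|c]; last by rewrite eqxx.
  by rewrite sumr_const mulr_natl.
by move=> c S _ /andP[].
Qed.

(** * Colourings of a path as words *)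

Fixpoint words (n : nat) : seq (seq C) :=
  if n is m.+1 then [seq c :: w | c <- enum C, w <- words m] else [:: [::]].

Definition weight (w : seq C) : R := \prod_(c <- w) x c.

Lemma mem_words n w : (w \in words n) = (size w == n).
Proof.
elim: n w => [|n IHn] [|c w] //=.
  by apply/negP => /allpairsP[[d v] [_ _]].
rewrite eqSS -IHn; apply/allpairsP/idP => [[[d v] /= [_ vn [_ ->]]]//|wn].
by exists (c, w); rewrite mem_enum.
Qed.

Lemma words_uniq n : uniq (words n).
Proof.
elim: n => //= n IHn; apply: allpairs_uniq => //; first exact: enum_uniq.
by move=> [c v] [d w] _ _ [-> ->].
Qed.

Lemma big_wordsS n (F : seq C -> R) :
  \sum_(w <- words n.+1) F w = \sum_c \sum_(w <- words n) F (c :: w).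
Proof. by rewrite /= big_allpairs_dep big_enum. Qed.

Lemma big_words_cat m n (F : seq C -> R) :
  \sum_(w <- words (m + n)) F w
  = \sum_(u <- words m) \sum_(v <- words n) F (u ++ v).
Proof.
elim: m F => [|m IHm] F; first by rewrite big_seq1.
by rewrite addSn !big_wordsS; apply: eq_bigr => c _; rewrite IHm.
Qed.

Lemma big_words_rev n (F : seq C -> R) :
  \sum_(w <- words n) F w = \sum_(w <- words n) F (rev w).
Proof.
rewrite -(big_map rev xpredT F); apply/perm_big/uniq_perm.
- exact: words_uniq.
- by rewrite (map_inj_uniq (can_inj revK)) words_uniq.
move=> w; rewrite mem_words -{2}(revK w) (mem_map (can_inj revK)) mem_words.
by rewrite size_rev.
Qed.

Lemma nth_map_ord n (k : 'I_n -> C) d (i : 'I_n) :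
  nth d [seq k j | j <- enum 'I_n] i = k i.
Proof. by rewrite (nth_map i) ?size_enum_ord // nth_ord_enum. Qed.

Lemma big_words_ffun n (F : seq C -> R) :
  \sum_(k : {ffun 'I_n -> C}) F [seq k i | i <- enum 'I_n]
  = \sum_(w <- words n) F w.
Proof.
pose h (k : {ffun 'I_n -> C}) := [seq k i | i <- enum 'I_n].
rewrite -(big_map h xpredT F); apply/perm_big/uniq_perm.
- rewrite map_inj_uniq ?index_enum_uniq // => k k' /eq_in_map kk'.
  by apply/ffunP => i; apply: kk'; rewrite mem_enum.
- exact: words_uniq.
move=> w; rewrite mem_words; apply/mapP/eqP => [[k _ ->]|szw].
  by rewrite size_map size_enum_ord.
(* An empty word offers no colour as the default of [nth], so $n=0$ is treated apart; any function
   on the empty domain serves there. *)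
case: w szw => [|c w] szw.
  move: szw => /= n0; subst n.
  have /card_gt0P[k _] : (0 < #|{ffun 'I_0 -> C}|)%N by rewrite card_ffun card_ord expn0.
  exists k; rewrite ?mem_index_enum // /h.
  by have := size_enum_ord 0; case: (enum 'I_0).
exists [ffun i : 'I_n => nth c (c :: w) i]; first by rewrite mem_index_enum.
apply: (@eq_from_nth _ c); first by rewrite size_map size_enum_ord.
move=> i; rewrite szw => ilt.
by rewrite (nth_map_ord _ _ (Ordinal ilt)) ffunE.
Qed.

Local Notation neq := (fun c d : C => c != d).

Definition path_sum n : R := \sum_(w <- words n | sorted neq w) weight w.

Definition path_sum_from n c : R :=
  \sum_(w <- words n | sorted neq w && (ohead w == Some c)) weight w.

Lemma path_sum0 : path_sum 0 = 1.
Proof. by rewrite /path_sum big_mkcond big_seq1 /weight big_nil. Qed.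

Lemma path_sum_from0 c : path_sum_from 0 c = 0.
Proof. by rewrite /path_sum_from big_mkcond big_seq1. Qed.

(** The condition [path neq c w] holds exactly for the properly coloured words that do not begin
    with $c$, the empty word included. *)
Lemma sum_avoid n c :
  \sum_(w <- words n | path neq c w) weight w = path_sum n - path_sum_from n c.
Proof.
rewrite /path_sum [in RHS](bigID (fun w => ohead w == Some c)) /= [X in X - _]addrC addrK.
apply: eq_bigl => -[|d w] //=; rewrite andbC; congr andb.
by rewrite (inj_eq Some_inj) eq_sym.
Qed.

(** No word begins with both $c$ and $d$, so the two exclusions are disjoint. *)
Lemma sum_avoid2 n c d : c != d ->
  \sum_(w <- words n | path neq c w && path neq d w) weight w
  = path_sum n - path_sum_from n c - path_sum_from n d.
Proof.
move=> cd; rewrite -sum_avoid [in RHS](bigID (path neq d)) /= -addrA.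
rewrite -[LHS]addr0; congr (_ + _); apply/esym/eqP; rewrite subr_eq0; apply/eqP.
apply: eq_bigl => -[|e w] //=.
have [->|ed] := eqVneq e d; first by rewrite cd eqxx andbT.
rewrite (inj_eq Some_inj) (negPf ed) /=.
by case: (path _ e w); rewrite ?andbF.
Qed.

Lemma path_sum_fromS n c :
  path_sum_from n.+1 c = x c * (path_sum n - path_sum_from n c).
Proof.
rewrite -sum_avoid /path_sum_from big_mkcond big_wordsS (bigD1 c) //=.
rewrite [X in _ + X]big1 ?addr0 => [|d dc].
  rewrite mulr_sumr [RHS]big_mkcond; apply: eq_bigr => w _.
  by rewrite eqxx andbT /weight big_cons.
by rewrite big1 // => w _; rewrite (inj_eq Some_inj) (negPf dc) andbF.
Qed.

Lemma sum_path_sum_fromS n : \sum_c path_sum_from n.+1 c = path_sum n.+1.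
Proof.
rewrite /path_sum [RHS]big_mkcond big_wordsS; apply: eq_bigr => c _.
rewrite path_sum_fromS -sum_avoid mulr_sumr big_mkcond.
by apply: eq_bigr => w _; rewrite /weight /= big_cons.
Qed.

(** * Proper colourings of paths and of twins *)

Definition is_proper (H : sgraph) (k : {ffun vertex H -> C}) : bool :=
  [forall u, forall v, edge u v ==> (k u != k v)].

Definition fin_chromsym (H : sgraph) : R :=
  \sum_(k : {ffun vertex H -> C} | is_proper k) \prod_u x (k u).

Lemma weight_ffun n (k : {ffun 'I_n -> C}) :
  weight [seq k i | i <- enum 'I_n] = \prod_i x (k i).
Proof. by rewrite /weight big_map big_enum. Qed.

Lemma is_proper_path n (k : {ffun 'I_n -> C}) :
  @is_proper (path_graph n) k = sorted neq [seq k i | i <- enum 'I_n].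
Proof.
case: n k => [|n] k.
  have -> : [seq k i | i <- enum 'I_0] = [::].
    by have := size_enum_ord 0; case: (enum 'I_0).
  by apply/forallP => -[].
apply/forallP/(sortedP (k ord0)) => [kp i|ks u].
  rewrite size_map size_enum_ord => iS.
  rewrite /= (nth_map_ord k _ (Ordinal (ltnW iS))) (nth_map_ord k _ (Ordinal iS)).
  apply: (implyP (forallP (kp (Ordinal (ltnW iS))) (Ordinal iS))).
  by rewrite /= /path_edge /= eqxx.
have step (i j : 'I_n.+1) : i.+1 = j -> k i != k j.
  move=> ij; have := ks i; rewrite size_map size_enum_ord ij ltn_ord => /(_ isT).
  by rewrite !nth_map_ord.
apply/forallP => v; apply/implyP => /= /orP[/eqP /step //|/eqP /step].
by rewrite eq_sym.
Qed.

Lemma fin_chromsym_path n : fin_chromsym (path_graph n) = path_sum n.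
Proof.
rewrite /path_sum [RHS]big_mkcond -big_words_ffun /fin_chromsym big_mkcond.
by apply: eq_bigr => k _; rewrite is_proper_path weight_ffun.
Qed.

(** The twins are adjacent and share their other neighbours, so the new vertex obeys the constraints
    of $v$ recoloured with $d$. Everything is thereby stated on [H] itself, and for a path both
    conditions become conditions on words. *)
Lemma is_proper_twin (H : sgraph) (v : vertex H) (d : C) (k : {ffun vertex H -> C}) :
  @is_proper (twin v) [ffun o => if o is Some u then k u else d]
  = [&& d != k v, is_proper k & is_proper [ffun u => if u == v then d else k u]].
Proof.
apply/forallP/and3P => [kp|[dv /forallP kp /forallP kp'] [u|]].
- have kpE o o' := implyP (forallP (kp o) o').
  have kp' u u' : edge u u' -> k u != k u'.
    by move=> e; have := kpE (Some u) (Some u') e; rewrite !ffunE.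
  have dp u : (u == v) || edge v u -> d != k u.
    by move=> e; have := kpE None (Some u) e; rewrite !ffunE.
  split; first by rewrite dp ?eqxx.
    by apply/forallP => u; apply/forallP => u'; apply/implyP/kp'.
  apply/forallP => u; apply/forallP => u'; apply/implyP => e; rewrite !ffunE.
  move: e; have [->|uv] := eqVneq u v; have [->|u'v] := eqVneq u' v => e.
  + by rewrite edge_irrefl in e.
  + by rewrite dp // e orbT.
  + by rewrite eq_sym dp // edge_sym e orbT.
  + exact: kp'.
- apply/forallP => -[u'|]; apply/implyP => /= e; rewrite !ffunE.
    exact: (implyP (forallP (kp u) u')).
  case/orP: e => [/eqP ->|e]; first by rewrite eq_sym.
  have := implyP (forallP (kp' u) v); rewrite edge_sym !ffunE eqxx => /(_ e).
  by have [uv|//] := eqVneq u v; rewrite uv edge_irrefl in e.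
- apply/forallP => -[u'|]; apply/implyP => //= e; rewrite !ffunE.
  case/orP: e => [/eqP ->|e] //.
  have := implyP (forallP (kp' v) u'); rewrite !ffunE eqxx => /(_ e).
  by have [uv|//] := eqVneq u' v; rewrite uv edge_irrefl in e.
Qed.

Lemma fin_chromsym_twin (H : sgraph) (v : vertex H) :
  fin_chromsym (twin v) = \sum_d \sum_(k : {ffun vertex H -> C} |
      [&& d != k v, is_proper k & is_proper [ffun u => if u == v then d else k u]])
    x d * \prod_u x (k u).
Proof.
rewrite pair_big_dep /= /fin_chromsym.
pose h (p : C * {ffun vertex H -> C}) : {ffun option (vertex H) -> C} :=
  [ffun o => if o is Some u then p.2 u else p.1].
pose g (k : {ffun option (vertex H) -> C}) := (k None, [ffun u => k (Some u)]).
have hK : cancel h g.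
  by move=> [d k]; rewrite /g ffunE; congr pair; apply/ffunP => u; rewrite !ffunE.
have gK : cancel g h by move=> k; apply/ffunP => -[u|]; rewrite !ffunE.
rewrite (reindex h); last by exists g => k _; [exact: hK | exact: gK].
apply: eq_big => [[d k]|[d k] _]; first exact: is_proper_twin.
rewrite (bigD1 None) //= ffunE /=; congr (_ * _).
rewrite (reindex_omap Some id) => [|[]//]; apply: eq_big => [u|u _].
  by rewrite eqxx.
by rewrite ffunE.
Qed.

Lemma sorted_rev_cons c (u v : seq C) :
  sorted neq (rev u ++ c :: v) = path neq c u && path neq c v.
Proof.
rewrite sorted_cat_cons -rev_cons rev_sorted /=; congr (_ && _).
by apply: eq_path => d e; rewrite eq_sym.
Qed.

(** Ordinals count from 0, so [v] has $a$ vertices before it and $b$ after it. Its colour is $c$ and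
    that of its twin is $d$. *)
Lemma fin_chromsym_twin_path a b (v : 'I_(a + b.+1)) : v = a :> nat ->
  @fin_chromsym (@twin (path_graph (a + b.+1)) v) =
  \sum_c \sum_(d | c != d) x c * x d *
    ((path_sum a - path_sum_from a c - path_sum_from a d) *
     (path_sum b - path_sum_from b c - path_sum_from b d)).
Proof.
move=> va; rewrite fin_chromsym_twin [RHS](exchange_big_dep xpredT) //=.
apply: eq_bigr => d _; rewrite big_mkcond /=.
(* This is the criterion of [is_proper_twin] on words: recolouring [v] replaces the letter at index
   $a$ by $d$. *)
pose F w := if [&& d != nth d w a, sorted neq w &
  sorted neq (take a w ++ d :: drop a.+1 w)] then x d * weight w else 0.
rewrite (eq_bigr (fun k : {ffun 'I_(a + b.+1) -> C} =>
  F [seq k i | i <- enum 'I_(a + b.+1)])).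
  (* The word is written [rev u ++ c :: w]; with the first block reversed, [u] and [w] are both read
     outwards from the twins. *)
  rewrite big_words_ffun big_words_cat big_words_rev.
  rewrite (eq_bigr (fun u => \sum_c \sum_(w <- words b)
     F (rev u ++ c :: w))) => [|u _]; last by rewrite big_wordsS.
  rewrite exchange_big /= [RHS]big_mkcond; apply: eq_bigr => c _.
  rewrite (eq_big_seq (fun u => \sum_(w <- words b) if c != d then x c * x d *
      ((if path neq c u && path neq d u then weight u else 0) *
       (if path neq c w && path neq d w then weight w else 0)) else 0)).
    case: ifP => cd; last by rewrite big1 // => u _; rewrite big1.
    rewrite -!sum_avoid2 // mulr_suml mulr_sumr [RHS]big_mkcond.
    apply: eq_bigr => u _; case: ifP => _.
      rewrite !mulr_sumr [RHS]big_mkcond; apply: eq_bigr => w _.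
      by case: ifP => _ //; rewrite !mulr0.
    by rewrite big1 // => w _; rewrite mul0r mulr0.
  move=> u; rewrite mem_words => /eqP su /=.
  apply: eq_bigr => w _; rewrite /F -su -(size_rev u) take_size_cat //.
  rewrite nth_cat ltnn subnn /= -cat_rcons drop_size_cat ?size_rcons //.
  rewrite cat_rcons !sorted_rev_cons [d == c]eq_sym; case: (c != d) => //=.
  rewrite andbACA; case: (path _ c u && _); last by rewrite mul0r mulr0.
  case: (path _ c w && _); last by rewrite !mulr0.
  by rewrite /weight big_cat /= (perm_big u) ?perm_rev // big_cons; ring.
move=> k _; rewrite !is_proper_path -weight_ffun /F.
have av : (a < a + b.+1)%N by lia.
have kv : nth d [seq k i | i <- enum 'I_(a + b.+1)] a = k v.
  by rewrite -(nth_map_ord k d v) va.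
have -> : [seq [ffun i => if i == v then d else k i] i | i <- enum 'I_(a + b.+1)]
  = take a [seq k i | i <- enum 'I_(a + b.+1)]
    ++ d :: drop a.+1 [seq k i | i <- enum 'I_(a + b.+1)].
  set w := [seq k i | i <- _]; have sw : size w = (a + b.+1)%N.
    by rewrite size_map size_enum_ord.
  apply: (@eq_from_nth _ d) => [|i]; rewrite size_map size_enum_ord.
    by rewrite size_cat /= size_takel ?size_drop sw; lia.
  move=> ilt; rewrite (nth_map_ord _ _ (Ordinal ilt)) ffunE -val_eqE /=.
  rewrite va nth_cat size_takel ?sw; last exact: ltnW.
  case: ltngtP => [ia|ia|->]; last by rewrite subnn.
    by rewrite nth_take // (nth_map_ord k _ (Ordinal ilt)).
  rewrite -(subnSK ia) /= nth_drop subnKC //.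
  by rewrite (nth_map_ord k _ (Ordinal ilt)).
by rewrite kv.
Qed.

End FiniteColours.

(** * Truncation to finitely many variables *)

Definition below (N : nat) (m : {mset nat}%mset) : bool := all (gtn N) m.

(* The image of f when all variables x_i with N <= i are set to 0. *)
Definition mtrunc (N : nat) (f : mser) : mser :=
  MSer (fun m => if below N m then mcoef f m else 0).

(** A monomial involves finitely many variables, so some truncation retains its coefficient.
    Identities of series thus reduce to finitely many colours. *)
Lemma mtrunc_inj (f g : mser) : (forall N, mtrunc N f = mtrunc N g) -> f = g.
Proof.
move=> fg; apply: mserP => m.
have mN : below (\max_(i <- (m : seq nat)) i).+1 m.
  by apply/allP => i im; rewrite /= ltnS; exact: leq_bigmax_seq.
by have := congr1 (mcoef^~ m) (fg (\max_(i <- (m : seq nat)) i).+1); rewrite /= mN.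
Qed.

(** A product of monomials survives truncation exactly when both factors do, which makes truncation
    multiplicative. *)
Lemma below_add N (a b : {mset nat}%mset) :
  below N (msetD a b) = below N a && below N b.
Proof.
apply/allP/andP => [abN|[/allP aN /allP bN] i].
  by split; apply/allP => i iab; apply: abN; rewrite in_msetD iab ?orbT.
by rewrite in_msetD => /orP[/aN|/bN].
Qed.

Section Truncation.
Variable N : nat.

Fact mtrunc_is_additive : zmod_morphism (mtrunc N).
Proof.
by move=> f g; apply: mserP => m /=; case: ifP => _; rewrite ?subrr.
Qed.

Fact mtrunc_is_multiplicative : monoid_morphism (mtrunc N).
Proof.
split=> [|f g]; apply: mserP => m /=.
  case: ifP => // /negP mN; case: eqP => // m0; case: mN; rewrite m0.
  by apply/allP => i; rewrite in_mset0.
rewrite big_seq [RHS]big_seq; case: ifP => mN.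
  apply: eq_bigr => a; rewrite mem_msubs => am.
  have := mN; rewrite -{1}(msetBDKC am) below_add => /andP[-> ->] //.
rewrite big1 // => a; rewrite mem_msubs => am.
have := mN; rewrite -{1}(msetBDKC am) below_add.
by case: ifP => _; case: ifP => _; rewrite ?mulr0 ?mul0r.
Qed.

HB.instance Definition _ :=
  GRing.isZmodMorphism.Build mser mser (mtrunc N) mtrunc_is_additive.
HB.instance Definition _ :=
  GRing.isMonoidMorphism.Build mser mser (mtrunc N) mtrunc_is_multiplicative.

Lemma mcoef_sum (I : finType) (Q : pred I) (F : I -> mser) m :
  mcoef (\sum_(i | Q i) F i) m = \sum_(i | Q i) mcoef (F i) m.
Proof. by apply: (big_morph (mcoef^~ m)). Qed.

(** Shared by [elemsym] and [chromsym]. Through [h], the [j] satisfying [Q] enumerate exactly the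
    indices in [A] whose monomials use only variables below $N$; truncation kills all other
    monomials. *)
Lemma mtrunc_msum (I : choiceType) (J : finType) (A : set I) (w : I -> seq nat)
    (Q : pred J) (h : J -> I) :
  injective h -> (forall j, Q j -> A (h j)) ->
  (forall j i, i \in w (h j) -> (i < N)%N) ->
  (forall i, A i -> all (gtn N) (w i) -> exists2 j, Q j & h j = i) ->
  mtrunc N (msum A (fun i => \prod_(c <- w i) mvar c))
  = \sum_(j | Q j) \prod_(c <- w (h j)) mvar c.
Proof.
move=> h_inj QA wh hsurj; apply: mserP => m; rewrite mcoef_sum /=.
have memw s : m = seq_mset s -> m =i s.
  by move=> ->; apply: perm_mem; exact: perm_eq_seq_mset.
case: ifP => mN; last first.
  rewrite big1 // => j _; rewrite coef_prod_mvar; case: eqP => // /memw em.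
  case/negP: mN; apply/allP => i; rewrite em; exact: wh.
rewrite -(@fsbig_widen _ _ _ _ (h @` [set` Q])%classic).
- rewrite fsbig_image; last by move=> i j _ _; apply: h_inj.
  by rewrite -(bigfs _ (index_enum_uniq J)) // => j _; rewrite mem_index_enum.
- by move=> _ [j Qj <-]; apply: QA.
move=> i [Ai nhi] /=; rewrite coef_prod_mvar; case: eqP => // /memw em.
case: nhi; have [|j Qj <-] := hsurj i Ai; last by exists j.
by apply/allP => c cw; move/allP: mN; apply; rewrite em.
Qed.

Lemma mtrunc_elemsym k :
  mtrunc N (elemsym k) = fin_elemsym (fun i : 'I_N => mvar i) k.
Proof.
pose h (S : {set 'I_N}) : {fset nat} := [fset val i | i in S]%fset.
rewrite /elemsym (@mtrunc_msum _ _ _ (fun S : {fset nat} => enum_fset S)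
  (fun S : {set 'I_N} => #|S| == k) h).
- apply: eq_bigr => S _; rewrite /h big_imfset /=; last by move=> i j _ _; apply: val_inj.
  exact: big_enum.
- move=> S T /fsetP ST; apply/setP => i; have := ST (val i).
  by rewrite !(mem_imfset _ _ val_inj).
- by move=> S /eqP <- /=; rewrite /h card_imfset /= -?cardE //; exact: val_inj.
- by move=> S i /imfsetP[j _ ->] /=; exact: ltn_ord.
move=> S Sk /allP SN.
have hS : h [set i : 'I_N | val i \in S] = S.
  apply/fsetP => i; apply/imfsetP/idP => [[j] |iS]; first by rewrite /= inE => ? ->.
  by exists (Ordinal (SN i iS)); rewrite //= inE.
exists [set i : 'I_N | val i \in S].
  by apply/eqP; rewrite -Sk -[in RHS]hS /h card_imfset /= -?cardE //; exact: val_inj.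
exact: hS.
Qed.

Lemma mtrunc_chromsym H :
  mtrunc N (chromsym H) = fin_chromsym (fun i : 'I_N => mvar i) H.
Proof.
pose h (k : {ffun vertex H -> 'I_N}) : {ffun vertex H -> nat} :=
  [ffun u => val (k u)].
pose w (k : {ffun vertex H -> nat}) := [seq k u | u <- enum (vertex H)].
have E (k : {ffun vertex H -> nat}) : \prod_u mvar (k u) = \prod_(c <- w k) mvar c.
  by rewrite big_map big_enum.
rewrite /chromsym (_ : msum _ _ = msum [set k | proper_coloring k]%classic
  (fun k => \prod_(c <- w k) mvar c)); last by congr msum; apply/funext => k.
rewrite (@mtrunc_msum _ _ _ w (@is_proper _ H) h).
- by apply: eq_bigr => k _; rewrite -E; apply: eq_bigr => u _; rewrite ffunE.
- move=> k k' /ffunP kk'; apply/ffunP => u; have := kk' u.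
  by rewrite !ffunE => /val_inj.
- move=> k /forallP kp u v e; rewrite !ffunE => /val_inj; apply/eqP.
  exact: (implyP (forallP (kp u) v)).
- by move=> k i /mapP[u _ ->]; rewrite ffunE; exact: ltn_ord.
move=> k kp /allP kN.
have klt u : (k u < N)%N by apply/kN/map_f; rewrite mem_enum.
exists [ffun u => Ordinal (klt u)]; last by apply/ffunP => u; rewrite !ffunE.
apply/forallP => u; apply/forallP => v; apply/implyP => e.
by rewrite !ffunE -val_eqE /=; apply/eqP/kp.
Qed.

End Truncation.

(** * The recurrence from the closed form *)

Section TwinRecurrence.
Variables (R : comNzRingType) (P E : nat -> R) (T : nat -> nat -> R).
Hypothesis P0 : P 0 = 1.
Hypothesis P1 : P 1 = E 1.
Hypothesis P2 : P 2 = 2 * E 2.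
Hypothesis P_rec : forall n,
  P n = E n + \sum_(2 <= j < n.+1) (j%:R - 1) * E j * P (n - j)%N.
Hypothesis T_closed : forall a b,
  T a b = 4 * P (a + b).+2 + 2 * E 1 * P (a + b).+1 - 2 * P a.+1 * P b.+1
    - 2 * P a * P b.+2 - 2 * P a.+2 * P b + 2 * E 2 * P a * P b.

Lemma closed_form_end a : T a 0 = 2 * P a.+2 - 2 * E 2 * P a.
Proof. by rewrite T_closed addn0 P0 P1 P2; ring. Qed.

Lemma closed_form_sym a b : T a b = T b a.
Proof. by rewrite !T_closed addnC; ring. Qed.

Local Notation term m := (fun j : nat => (j%:R - 1) * E j * P (m - j)%N).

(** The term at $j=1$ vanishes. Including it allows sums to be split at any $b\ge1$. *)
Lemma sum_from1 m (F : nat -> R) : (0 < m)%N ->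
  \sum_(2 <= j < m) (j%:R - 1) * E j * F j
  = \sum_(1 <= j < m) (j%:R - 1) * E j * F j.
Proof.
case: m => [|[|m]] // _.
by rewrite [RHS]big_ltn // subrr !mul0r add0r.
Qed.

Let P_tail m b : (0 < b)%N -> (b <= m.+1)%N ->
  P m = E m + \sum_(1 <= j < b) term m j + \sum_(b <= j < m.+1) term m j.
Proof.
move=> b0 bm; rewrite {1}P_rec -addrA -big_cat_nat //; congr (_ + _).
exact: (@sum_from1 m.+1 (fun j => P (m - j)%N)).
Qed.

(** Here $a=\ell-1$ and $b=n-\ell$. Each factor of the closed form whose index involves $b$ is
    expanded by the path recursion and split at $j=b$. By linearity the parts with $j<b$ assemble
    into the sum of $(j-1)e_jT(a,b-j)$, and the tails give the explicit terms. *)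
Lemma closed_form_recurrence a b : (0 < a)%N -> (0 < b)%N ->
  T a b = \sum_(2 <= j < b) (j%:R - 1) * E j * T a (b - j)
    + 4 * ((a + b.+1)%:R + 1) * E (a + b.+1 + 1)
    + 2 * (a + b.+1)%:R * E 1 * E (a + b.+1)
    + 2 * E 1 * \sum_(b + 2 <= j < a + b.+1) (j%:R - 1) * E j * P (a + b.+1 - j)
    + 4 * \sum_(b + 3 <= j < a + b.+1 + 1)
        (j%:R - 1) * E j * P (a + b.+1 + 1 - j)
    + 2 * \sum_(b + 1 <= j < b + 3)
        (j%:R - 2) * E j * P (a + b.+1 + 1 - j)
    + (b%:R - 2) * E b * T a 0.
Proof.
move=> a0 b0.
have -> : \sum_(2 <= j < b) (j%:R - 1) * E j * T a (b - j) =
    4 * (\sum_(1 <= j < b) term (a + b).+2 j)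
    + 2 * E 1 * (\sum_(1 <= j < b) term (a + b).+1 j)
    - 2 * P a.+1 * (\sum_(1 <= j < b) term b.+1 j)
    - 2 * P a * (\sum_(1 <= j < b) term b.+2 j)
    - 2 * P a.+2 * (\sum_(1 <= j < b) term b j)
    + 2 * E 2 * P a * (\sum_(1 <= j < b) term b j).
  rewrite (@sum_from1 b (fun j => T a (b - j)%N)) // !mulr_sumr -!sumrN -!big_split /=.
  rewrite big_nat [RHS]big_nat; apply: eq_bigr => j /andP[_ jb].
  have -> : ((a + b).+2 - j = (a + (b - j)).+2)%N by lia.
  have -> : ((a + b).+1 - j = (a + (b - j)).+1)%N by lia.
  have -> : (b.+2 - j = (b - j).+2)%N by lia.
  have -> : (b.+1 - j = (b - j).+1)%N by lia.
  rewrite T_closed.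
  by ring.
have tail0 : \sum_(b <= j < b.+1) term b j = (b%:R - 1) * E b.
  by rewrite big_nat1 subnn P0 mulr1.
have tail1 : \sum_(b <= j < b.+2) term b.+1 j
    = (b%:R - 1) * E b * E 1 + b%:R * E b.+1.
  by rewrite big_ltn // big_nat1 subSnn subnn P0 P1; ring.
have tail2 : \sum_(b <= j < b.+3) term b.+2 j
    = (b%:R - 1) * E b * (2 * E 2) + b%:R * E b.+1 * E 1 + b.+1%:R * E b.+2.
  rewrite big_ltn; last by lia.
  rewrite big_ltn; last by lia.
  rewrite big_nat1 subnn subSnn.
  have -> : (b.+2 - b = 2)%N by lia.
  by rewrite P0 P1 P2; ring.
(* Since $a>0$, the last index $a+b+1$ differs from the split-off indices $b$ and $b+1$. *)
have tail3 : \sum_(b <= j < (a + b).+2) term (a + b).+1 j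
    = (b%:R - 1) * E b * P a.+1 + b%:R * E b.+1 * P a
      + \sum_(b.+2 <= j < (a + b).+1) term (a + b).+1 j
      + (a + b)%:R * E (a + b).+1.
  rewrite big_ltn; last by lia.
  rewrite big_ltn; last by lia.
  rewrite big_nat_recr /=; last by lia.
  rewrite subnn P0.
  have -> : ((a + b).+1 - b = a.+1)%N by lia.
  have -> : ((a + b).+1 - b.+1 = a)%N by lia.
  by ring.
have tail4 : \sum_(b <= j < (a + b).+3) term (a + b).+2 j
    = (b%:R - 1) * E b * P a.+2 + b%:R * E b.+1 * P a.+1
      + b.+1%:R * E b.+2 * P a
      + \sum_(b.+3 <= j < (a + b).+2) term (a + b).+2 j
      + (a + b).+1%:R * E (a + b).+2.
  rewrite big_ltn; last by lia.
  rewrite big_ltn; last by lia.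
  rewrite big_ltn; last by lia.
  rewrite big_nat_recr /=; last by lia.
  rewrite subnn P0.
  have -> : ((a + b).+2 - b = a.+2)%N by lia.
  have -> : ((a + b).+2 - b.+1 = a.+1)%N by lia.
  have -> : ((a + b).+2 - b.+2 = a)%N by lia.
  by ring.
have mid : \sum_(b.+1 <= j < b.+3) (j%:R - 2) * E j * P ((a + b).+2 - j)
    = (b%:R - 1) * E b.+1 * P a.+1 + b%:R * E b.+2 * P a.
  rewrite big_ltn; last by lia.
  rewrite big_nat1.
  have -> : ((a + b).+2 - b.+1 = a.+1)%N by lia.
  have -> : ((a + b).+2 - b.+2 = a)%N by lia.
  by ring.
(* The tails contribute $(b-1)e_bT(a,0)$, and the leading term $e_b$ of $P_b$ contributes
   $-e_bT(a,0)$, whence the coefficient $b-2$. The leading terms of $P_{b+1}$ and $P_{b+2}$ likewise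
   lower $j-1$ to $j-2$ in the middle sum. *)
rewrite T_closed closed_form_end !addnS !addn0 mid.
rewrite (@P_tail (a + b).+2 b) // ?(@P_tail (a + b).+1 b) //; try lia.
rewrite (@P_tail b.+1 b) // ?(@P_tail b.+2 b) // ?(@P_tail b b) //; try lia.
rewrite tail0 tail1 tail2 tail3 tail4.
by ring.
Qed.

End TwinRecurrence.

(** * Chromatic symmetric functions of twinned paths *)

Lemma chromsym_path0 : chromsym (path_graph 0) = 1.
Proof.
apply: mtrunc_inj => N.
by rewrite mtrunc_chromsym rmorph1 fin_chromsym_path path_sum0.
Qed.

Lemma chromsym_path_rec n :
  chromsym (path_graph n) = elemsym n
    + \sum_(2 <= j < n.+1) (j%:R - 1) * elemsym j * chromsym (path_graph (n - j)).
Proof.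
apply: mtrunc_inj => N; rewrite rmorphD rmorph_sum /=.
under [X in _ + X]eq_bigr do
  rewrite !rmorphM rmorphB rmorph1 rmorph_nat /= mtrunc_elemsym mtrunc_chromsym
    fin_chromsym_path.
rewrite mtrunc_chromsym mtrunc_elemsym fin_chromsym_path.
exact: (path_recursion (path_sum0 _) (fin_elemsym0 _) (path_sum_from0 _)
  (fin_elemsym_at0 _) (path_sum_fromS _) (fin_elemsym_atS _)
  (sum_path_sum_fromS _) (sum_fin_elemsym_at _)).
Qed.

Lemma chromsym_path1 : chromsym (path_graph 1) = elemsym 1.
Proof. by rewrite chromsym_path_rec big_geq // addr0. Qed.

Lemma chromsym_path2 : chromsym (path_graph 2) = 2 * elemsym 2.
Proof. by rewrite chromsym_path_rec big_nat1 subnn chromsym_path0; ring. Qed.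

Lemma chromsym_twinned_path a b :
  chromsym (twinned_path (a + b.+1) a.+1) =
    4 * chromsym (path_graph (a + b).+2)
    + 2 * elemsym 1 * chromsym (path_graph (a + b).+1)
    - 2 * chromsym (path_graph a.+1) * chromsym (path_graph b.+1)
    - 2 * chromsym (path_graph a) * chromsym (path_graph b.+2)
    - 2 * chromsym (path_graph a.+2) * chromsym (path_graph b)
    + 2 * elemsym 2 * chromsym (path_graph a) * chromsym (path_graph b).
Proof.
rewrite /twinned_path; case: pickP => [v /eqP[va]|nov]; last first.
  have alt : (a < a + b.+1)%N by lia.
  by have := nov (Ordinal alt); rewrite /= eqxx.
apply: mtrunc_inj => N.
rewrite !(rmorph_nat, rmorph1, rmorphD, rmorphN, rmorphM) /= !mtrunc_elemsym.
rewrite !mtrunc_chromsym !fin_chromsym_path (fin_chromsym_twin_path _ va).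
exact: (twin_sum (path_sum0 _) (fin_elemsym0 _) (path_sum_from0 _)
  (fin_elemsym_at0 _) (path_sum_fromS _) (fin_elemsym_atS _)
  (sum_path_sum_fromS _) (sum_fin_elemsym_at _)).
Qed.

(* Repeated monomials replace nonnegative coefficients, and the factors of a
   monomial need not be sorted. *)
Definition e_monomial_sum (f : mser) : Prop :=
  exists2 s : seq (seq nat), all (fun la => 0%N \notin la) s &
    f = \sum_(la <- s) elemsym_part la.

(** Sorting turns each monomial into a partition, and multiplicities become the coefficients. *)
Lemma e_monomial_sum_positive f : e_monomial_sum f -> e_positive f.
Proof.
move=> [s s0 ->]; pose t := [seq sort geq la | la <- s].
have -> : \sum_(la <- s) elemsym_part la = \sum_(la <- t) elemsym_part la.
  rewrite big_map; apply: eq_bigr => la _.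
  by apply: perm_big; rewrite perm_sym perm_sort.
pose c : {fsfun seq nat -> int with 0} :=
  [fsfun la in seq_fset tt t => (count_mem la t)%:Z | 0].
have cE la : c la = (count_mem la t)%:Z.
  rewrite fsfunE seq_fsetE; case: ifP => // /negbT /count_memPn ->.
  by [].
have suppE : finsupp c =i undup t.
  move=> la; rewrite mem_finsupp cE mem_undup -has_pred1 has_count.
  by case: (count_mem la t).
exists c; last by move=> la; rewrite cE.
split=> [la|].
  rewrite suppE mem_undup => /mapP[mu mus ->]; apply/andP; split.
    by apply: sort_sorted => i j; exact: leq_total.
  by rewrite mem_sort; exact: (allP s0).
rewrite -big_undup_iterop_count.
rewrite -(perm_big _ (uniq_perm _ _ suppE)) ?undup_uniq ?fset_uniq //=.
apply: eq_bigr => la _.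
by rewrite cE -pmulrn mulr_natl.
Qed.

(** * Closure properties of sums of elementary monomials *)

Lemma e_monomial_sum0 : e_monomial_sum 0.
Proof. by exists [::]; rewrite ?big_nil. Qed.

Lemma e_monomial_sum1 : e_monomial_sum 1.
Proof. by exists [:: [::]]; rewrite ?big_seq1 /elemsym_part ?big_nil. Qed.

Lemma e_monomial_sum_elemsym k : (0 < k)%N -> e_monomial_sum (elemsym k).
Proof.
move=> k0; exists [:: [:: k]]; rewrite /elemsym_part ?big_seq1 //.
by rewrite /= inE eq_sym -lt0n k0.
Qed.

Lemma e_monomial_sumD f g :
  e_monomial_sum f -> e_monomial_sum g -> e_monomial_sum (f + g).
Proof.
move=> [s s0 ->] [t t0 ->]; exists (s ++ t); last by rewrite big_cat.
by rewrite all_cat s0.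
Qed.

Lemma e_monomial_sumM f g :
  e_monomial_sum f -> e_monomial_sum g -> e_monomial_sum (f * g).
Proof.
move=> [s /allP s0 ->] [t /allP t0 ->]; exists [seq la ++ mu | la <- s, mu <- t].
  apply/allP => nu /allpairsP[[la mu] /= [las mut ->]].
  by rewrite mem_cat negb_or s0 ?t0.
rewrite big_allpairs_dep mulr_suml; apply: eq_bigr => la _; rewrite mulr_sumr.
by apply: eq_bigr => mu _; rewrite /elemsym_part big_cat.
Qed.

Lemma e_monomial_sum_nat k : e_monomial_sum k%:R.
Proof.
elim: k => [|k IHk]; first exact: e_monomial_sum0.
by rewrite -natr1; apply: e_monomial_sumD IHk e_monomial_sum1.
Qed.

Lemma e_monomial_sum_natB k i : (i <= k)%N -> e_monomial_sum (k%:R - i%:R).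
Proof. by move=> ik; rewrite -natrB //; exact: e_monomial_sum_nat. Qed.

Lemma e_monomial_sum_sum m n (F : nat -> mser) :
  (forall j, (m <= j < n)%N -> e_monomial_sum (F j)) ->
  e_monomial_sum (\sum_(m <= j < n) F j).
Proof.
move=> FP; rewrite big_nat; apply: big_ind => //; first exact: e_monomial_sum0.
exact: e_monomial_sumD.
Qed.

Lemma e_monomial_sum_path n : e_monomial_sum (chromsym (path_graph n)).
Proof.
elim/ltn_ind: n => -[|n] IHn; first by rewrite chromsym_path0; exact: e_monomial_sum1.
rewrite chromsym_path_rec; apply: e_monomial_sumD; first exact: e_monomial_sum_elemsym.
apply: e_monomial_sum_sum => j /andP[j2 jn]; apply: e_monomial_sumM.
  apply: e_monomial_sumM; last by apply: e_monomial_sum_elemsym; lia.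
  by apply: (@e_monomial_sum_natB _ 1); lia.
by apply: IHn; lia.
Qed.

(** * The recurrence and $e$-positivity for twinned paths *)

Lemma twinned_path_sym a b :
  chromsym (twinned_path (a + b.+1) a.+1) = chromsym (twinned_path (b + a.+1) b.+1).
Proof. exact: (closed_form_sym chromsym_twinned_path). Qed.

Lemma chromsym_twinned_leaf a :
  chromsym (twinned_path a.+1 a.+1)
  = 2 * chromsym (path_graph a.+2) - 2 * elemsym 2 * chromsym (path_graph a).
Proof.
have := closed_form_end chromsym_path0 chromsym_path1 chromsym_path2
  chromsym_twinned_path a.
by rewrite addn1.
Qed.

Lemma twinned_path_recurrence n l : (2 <= l)%N -> (l + 1 <= n)%N ->
    chromsym (twinned_path n l) =
        \sum_(2 <= j < n - l)
          (j%:R - 1) * elemsym j * chromsym (twinned_path (n - j) l)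
      + 4%:R * (n%:R + 1) * elemsym (n + 1)
      + 2%:R * n%:R * elemsym 1 * elemsym n
      + 2%:R * elemsym 1 *
          \sum_(n - l + 2 <= j < n)
            (j%:R - 1) * elemsym j * chromsym (path_graph (n - j))
      + 4%:R *
          \sum_(n - l + 3 <= j < n + 1)
            (j%:R - 1) * elemsym j * chromsym (path_graph (n + 1 - j))
      + 2%:R *
          \sum_(n - l + 1 <= j < n - l + 3)
            (j%:R - 2%:R) * elemsym j * chromsym (path_graph (n + 1 - j))
      + (n%:R - l%:R - 2%:R) * elemsym (n - l) * chromsym (twinned_path l l).
Proof.
case: l => [|a] // a0 an.
have [b b0 ->] : exists2 b, (0 < b)%N & n = (a + b.+1)%N.
  by exists (n - a.+1)%N; lia.
rewrite (closed_form_recurrence chromsym_path0 chromsym_path1 chromsym_path2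
  chromsym_path_rec chromsym_twinned_path) //.
have -> : (a + b.+1 - a.+1 = b)%N by lia.
have -> : ((a + b.+1)%:R - a.+1%:R - 2 : mser) = b%:R - 2 by ring.
rewrite (addn1 a); do 6! congr (_ + _).
rewrite big_nat [RHS]big_nat; apply: eq_bigr => j /andP[_ jb].
by congr (_ * chromsym (twinned_path _ _)); lia.
Qed.

(** The subtracted $2e_2P_a$ is exactly twice the $j=2$ term in the recursion for $P_{a+2}$. *)
Lemma e_monomial_sum_twinned_leaf a : e_monomial_sum (chromsym (twinned_path a.+1 a.+1)).
Proof.
rewrite chromsym_twinned_leaf (chromsym_path_rec a.+2) big_ltn //.
rewrite (_ : a.+2 - 2 = a)%N; last by lia.
set S := \sum_(_ <= _ < _) _.
rewrite (_ : _ - _ = 2 * (elemsym a.+2 + S)); last by ring.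
apply: e_monomial_sumM; first exact: (e_monomial_sum_nat 2).
apply: e_monomial_sumD; first exact: e_monomial_sum_elemsym.
apply: e_monomial_sum_sum => j /andP[j2 jn]; apply: e_monomial_sumM.
  apply: e_monomial_sumM; last by apply: e_monomial_sum_elemsym; lia.
  by apply: (@e_monomial_sum_natB _ 1); lia.
exact: e_monomial_sum_path.
Qed.

(** For $b\ge2$ every coefficient of the recurrence is nonnegative, including the last one,
    $b-2$. *)
Lemma e_monomial_sum_twinned_step a b : (0 < a)%N -> (1 < b)%N ->
  (forall i, (0 < i < b)%N -> e_monomial_sum (chromsym (twinned_path (a + i.+1) a.+1))) ->
  e_monomial_sum (chromsym (twinned_path (a + b.+1) a.+1)).
Proof.
move=> a0 b1 IH; rewrite twinned_path_recurrence; [|lia|lia].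
have n1 : (0 < a + b.+1)%N by lia.
have -> : (a + b.+1 - a.+1 = b)%N by lia.
have term_pos i k j H : (i <= j)%N -> (0 < j)%N -> e_monomial_sum (chromsym H) ->
    k = i%:R -> e_monomial_sum ((j%:R - k) * elemsym j * chromsym H).
  move=> ij j0 HP ->; apply: e_monomial_sumM HP.
  by apply: e_monomial_sumM (e_monomial_sum_elemsym j0); exact: e_monomial_sum_natB.
repeat apply: e_monomial_sumD.
- apply: e_monomial_sum_sum => j /andP[j2 jb]; apply: (term_pos 1%N) => //; try lia.
  have -> : (a + b.+1 - j = a + (b - j).+1)%N by lia.
  by apply: IH; lia.
- rewrite natr1 -natrM addn1; apply: e_monomial_sumM; first exact: e_monomial_sum_nat.
  exact: e_monomial_sum_elemsym.
- rewrite -natrM; apply: e_monomial_sumM (e_monomial_sum_elemsym n1).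
  apply: e_monomial_sumM; first exact: e_monomial_sum_nat.
  exact: e_monomial_sum_elemsym.
- apply: e_monomial_sumM.
    apply: e_monomial_sumM; first exact: e_monomial_sum_nat.
    exact: e_monomial_sum_elemsym.
  apply: e_monomial_sum_sum => j /andP[j2 jb]; apply: (term_pos 1%N) => //; try lia.
  exact: e_monomial_sum_path.
- apply: e_monomial_sumM; first exact: e_monomial_sum_nat.
  apply: e_monomial_sum_sum => j /andP[j2 jb]; apply: (term_pos 1%N) => //; try lia.
  exact: e_monomial_sum_path.
- apply: e_monomial_sumM; first exact: e_monomial_sum_nat.
  apply: e_monomial_sum_sum => j /andP[j2 jb]; apply: (term_pos 2%N) => //; try lia.
  exact: e_monomial_sum_path.
- have -> : ((a + b.+1)%:R - a.+1%:R - 2 : mser) = b%:R - 2 by ring.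
  apply: (term_pos 2%N) => //; first lia.
  exact: e_monomial_sum_twinned_leaf.
Qed.

(** At $n=3$, $\ell=2$ the last coefficient of the recurrence would be $-1$; in the closed form all
    negative terms cancel. *)
Lemma chromsym_twinned_path32 :
  chromsym (twinned_path 3 2) = 16 * elemsym 4 + 2 * elemsym 1 * elemsym 3.
Proof.
have P3 : chromsym (path_graph 3) = 3 * elemsym 3 + elemsym 2 * elemsym 1.
  rewrite chromsym_path_rec big_ltn // big_nat1 chromsym_path0 chromsym_path1.
  by ring.
have P4 : chromsym (path_graph 4)
    = 4 * elemsym 4 + 2 * elemsym 3 * elemsym 1 + 2 * elemsym 2 * elemsym 2.
  rewrite chromsym_path_rec big_ltn // big_ltn // big_nat1.
  by rewrite chromsym_path0 chromsym_path1 chromsym_path2; ring.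
rewrite (chromsym_twinned_path 1 1) P3 P4 chromsym_path1 chromsym_path2.
by ring.
Qed.

Lemma e_monomial_sum_twinned_path a b : (0 < a)%N -> (0 < b)%N ->
  e_monomial_sum (chromsym (twinned_path (a + b.+1) a.+1)).
Proof.
have pos2 i : (0 < i)%N -> e_monomial_sum (chromsym (twinned_path (1 + i.+1) 2)).
  elim/ltn_ind: i => -[|[|i]] IHi // _.
    rewrite chromsym_twinned_path32.
    apply: e_monomial_sumD; apply: e_monomial_sumM; try exact: e_monomial_sum_elemsym.
      exact: (e_monomial_sum_nat 16).
    apply: e_monomial_sumM; last exact: e_monomial_sum_elemsym.
    exact: (e_monomial_sum_nat 2).
  by apply: e_monomial_sum_twinned_step => // j /andP[j0 ji]; apply: IHi.
(* At $b=1$ the step does not apply; reversing the path leads to $\ell=2$, settled in [pos2] by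
   induction from $n=3$. *)
move=> a0; elim/ltn_ind: b => -[|[|b]] IHb // _.
  by rewrite twinned_path_sym; exact: pos2.
by apply: e_monomial_sum_twinned_step => // j /andP[j0 jb]; apply: IHb.
Qed.

Theorem theorem4p4 :
  (forall n l : nat, (2 <= l)%N -> (l + 1 <= n)%N -> (4 <= n)%N ->
    chromsym (twinned_path n l) =
        \sum_(2 <= j < n - l)
          (j%:R - 1) * elemsym j * chromsym (twinned_path (n - j) l)
      + 4%:R * (n%:R + 1) * elemsym (n + 1)
      + 2%:R * n%:R * elemsym 1 * elemsym n
      + 2%:R * elemsym 1 *
          \sum_(n - l + 2 <= j < n)
            (j%:R - 1) * elemsym j * chromsym (path_graph (n - j))
      + 4%:R *
          \sum_(n - l + 3 <= j < n + 1)
            (j%:R - 1) * elemsym j * chromsym (path_graph (n + 1 - j))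
      + 2%:R *
          \sum_(n - l + 1 <= j < n - l + 3)
            (j%:R - 2%:R) * elemsym j * chromsym (path_graph (n + 1 - j))
      + (n%:R - l%:R - 2%:R) * elemsym (n - l) * chromsym (twinned_path l l))
  /\
  (forall n l : nat, (3 <= n)%N -> (2 <= l)%N -> (l <= n - 1)%N ->
    e_positive (chromsym (twinned_path n l))).
Proof.
split=> [n l l2 ln _|n [|a] // n3 a0 an]; first exact: twinned_path_recurrence.
apply: e_monomial_sum_positive.
have -> : n = (a + (n - a.+1).+1)%N by lia.
by apply: e_monomial_sum_twinned_path; lia.
Qed.
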